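(* Let $n>1$ be an odd integer. Then $$\sum_{k=0}^{n-1}\frac{(q^{-1};q^2)_k^2}{(q^2;q^2)_k^2}\, q^{2k}\equiv 0 \pmod{[n]^2}$$ and $$\sum_{k=0}^{\frac{n+1}{2}}\frac{(q^{-1};q^2)_k^2}{(q^2;q^2)_k^2}\, q^{2k}\equiv 0 \pmod{[n]^2}.$$
   Context: Here $q$ is an indeterminate. Notation: $(a;q)_k=(1-a)(1-aq)\cdots(1-aq^{k-1})$ for $k\ge 1$, $(a;q)_0=1$ (so $(x;q^2)_k=\prod_{i=0}^{k-1}(1-xq^{2i})$). $[n]=1+q+\cdots+q^{n-1}$. For a rational function $A(q)$ and a polynomial $P(q)$, $A(q)\equiv 0\pmod{P(q)}$ means that $A(q)=P(q)U(q)/V(q)$ with polynomials $U,V$ (over $\mathbb{Q}$), where $V$ is relatively prime to $P$. *)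

(* Defs.v *)
From mathcomp Require Import all_boot all_order all_algebra.

Set Implicit Arguments.
Unset Strict Implicit.
Unset Printing Implicit Defensive.

Import GRing.Theory.
Local Open Scope ring_scope.

Definition qpoch (R : pzRingType) (a q : R) (k : nat) : R :=
  \prod_(0 <= i < k) (1 - a * q ^+ i).

Definition ratfun : fieldType := {fraction {poly rat}}.

Definition q : ratfun := tofrac ('X : {poly rat}).

Definition qint (n : nat) : {poly rat} := \sum_(0 <= i < n) 'X^i.

(* A = 0 mod P for a rational function A. The condition V != 0 matters only
   when P is a nonzero constant, since coprimep P 0 then holds. *)
Definition ratfun_eq0_mod (A : ratfun) (P : {poly rat}) : Prop :=
  exists U V : {poly rat},
    [/\ V != 0, coprimep P V & A = tofrac (P * U) / tofrac V].

(* Main.v *)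
Require Import Defs.
From mathcomp Require Import all_boot all_order all_algebra.
From mathcomp Require Import ring zify.

Set Implicit Arguments.
Unset Strict Implicit.
Unset Printing Implicit Defensive.

Import GRing.Theory.
Local Open Scope ring_scope.

(** The truncated sum has a closed form for every M:
<<
  sum_{k <= M} (q^-1; q^2)_k^2 / (q^2; q^2)_k^2 q^(2k)
     = ((q; q^2)_M / (q^2; q^2)_M)^2 * ([2M] + [2M+1]),
>>
so both congruences reduce to one divisibility, for M = n - 1 and for
M = (n + 1) / 2: up to factors coprime to [n], the quotient
(q; q^2)_M / (q^2; q^2)_M is a multiple of [n].

To find the closed form, replace (q^-1; q^2)_k^2 by
(a q^-1; q^2)_k (q^-1 / a; q^2)_k. The sum up to M is then a symmetric Laurent
polynomial in a, with terms from a^-M to a^M. By the q-Chu-Vandermonde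
formula it vanishes at a = q^(+-(2m-1)) for 2 <= m <= M, which leaves a single
factor of the form alpha + beta (a + 1/a). Its two coefficients are read off
from the coefficient of a^M and from the value at a = q, and a = 1 gives the
formula. Once known, it is proved by induction on M (sum_qpoch_ratio).

For the divisibility, splitting (q; q)_(2M) and (q^2; q^2)_M yields
<<
  (q; q^2)_M / (q^2; q^2)_M = qbinom(2M, M) / (-q; q)_M^2.
>>
For odd n the polynomial [n] is coprime to every 1 + q^i: modulo a common
factor q^(i n) would be both 1 and -1. This removes (-q; q)_M, and no separate
study of the cyclotomic factors of [n] is needed (sum_eq0_mod). That [n]
divides the central q-binomial coefficient follows from two identities
<<
  qbinom(2n-2, n-1) [n-1] = qbinom(2n-2, n) [n],
  qbinom(2M, M) [M] [M-1] = qbinom(2M-2, M) [2M] [2M-1],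
>>
because [m] and [n] are coprime as soon as m and n are. The first is the
divisibility behind the q-Catalan numbers (qint_dvd_central); the second has
2M - 1 = n (qint_dvd_central_pred). *)

Lemma qpoch0 (R : pzRingType) (a q : R) : qpoch a q 0 = 1.
Proof. by rewrite /qpoch big_nil. Qed.

Lemma qpochS (R : pzRingType) (a q : R) k :
  qpoch a q k.+1 = qpoch a q k * (1 - a * q ^+ k).
Proof. by rewrite /qpoch big_nat_recr. Qed.

Lemma qpochSl (R : pzRingType) (a q : R) k :
  qpoch a q k.+1 = (1 - a) * qpoch (a * q) q k.
Proof.
rewrite /qpoch big_nat_recl // expr0 mulr1; congr (_ * _).
by apply: eq_bigr => i _; rewrite exprS mulrA.
Qed.

Lemma rmorph_qpoch (R S : pzRingType) (f : {rmorphism R -> S}) a q k :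
  f (qpoch a q k) = qpoch (f a) (f q) k.
Proof.
rewrite /qpoch rmorph_prod; apply: eq_bigr => i _.
by rewrite rmorphB rmorph1 rmorphM rmorphXn.
Qed.

Lemma geomM (R : comPzRingType) (q : R) m :
  (1 - q) * (\sum_(0 <= i < m) q ^+ i) = 1 - q ^+ m.
Proof. by rewrite big_mkord -[1 - q ^+ m]opprB subrX1 -mulNr opprB. Qed.

(** The closed form of the truncated sum. In the induction step the factors
(q; q^2)_M and (q^2; q^2)_M come out, since
(q^-1; q^2)_(M+1) = (1 - q^-1) (q; q^2)_M, and what remains is a rational
identity in q and x = q^(2M). *)
Lemma sum_qpoch_ratio (F : fieldType) (q : F) (M : nat) :
    q != 0 -> (forall i, (0 < i)%N -> q ^+ i != 1) ->
  \sum_(0 <= k < M.+1)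
      qpoch q^-1 (q ^+ 2) k ^+ 2 / qpoch (q ^+ 2) (q ^+ 2) k ^+ 2
      * q ^+ (2 * k)
  = qpoch q (q ^+ 2) M ^+ 2 / qpoch (q ^+ 2) (q ^+ 2) M ^+ 2
    * (\sum_(0 <= i < 2 * M) q ^+ i + \sum_(0 <= i < (2 * M).+1) q ^+ i).
Proof.
move=> q0 q1.
have geomE m : \sum_(0 <= i < m) q ^+ i = (1 - q ^+ m) / (1 - q).
  by rewrite -geomM mulrAC divff ?mul1r // subr_eq0 eq_sym -(expr1 q) q1.
have E0 k : qpoch (q ^+ 2) (q ^+ 2) k != 0.
  elim: k => [|k IH]; first by rewrite qpoch0 oner_eq0.
  by rewrite qpochS mulf_neq0 // subr_eq0 eq_sym -exprS -exprM q1.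
have q1' : 1 - q != 0 by rewrite subr_eq0 eq_sym -(expr1 q) q1.
elim: M => [|M IH].
  by rewrite big_nat1 !qpoch0 muln0 big_nil big_nat1 expr0 add0r.
rewrite big_nat_recr //= IH !geomE.
have -> : qpoch q^-1 (q ^+ 2) M.+1 = (1 - q^-1) * qpoch q (q ^+ 2) M.
  by rewrite qpochSl expr2 mulKf.
have x1 : 1 - q ^+ 2 * q ^+ (2 * M) != 0.
  by rewrite subr_eq0 eq_sym -(exprD _ 2) q1.
have E1 := E0 M.
rewrite !qpochS mulnS -!exprM (exprS _ (2 + _)) (exprS _ (2 * M)) (exprD _ 2 (2 * M)).
move: (q ^+ (2 * M)) (qpoch q _ M) (qpoch _ _ M) x1 E1 => x O E x1 E1.
by field; rewrite q0 q1' E1 x1.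
Qed.

(** The q-binomial coefficient of a + b over a is a polynomial: this is the
q-Pascal rule, in the form
1 - X^(a+b+2) = (1 - X^(a+1)) + X^(a+1) (1 - X^(b+1)). *)
Lemma qpochDdvd a b :
  qpoch 'X 'X a * qpoch 'X 'X b %| (qpoch 'X 'X (a + b) : {poly rat}).
Proof.
elim: a b => [|a IHa] b; first by rewrite qpoch0 mul1r add0n.
elim: b => [|b IHb]; first by rewrite qpoch0 mulr1 addn0.
have -> : qpoch 'X 'X (a.+1 + b.+1) =
    qpoch 'X 'X (a + b.+1) * (1 - 'X * 'X^a)
    + qpoch 'X 'X (a.+1 + b) * (1 - 'X * 'X^b) * 'X^(a.+1) :> {poly rat}.
  rewrite addSn qpochS addnS -addSn exprD exprS.
  by set Y := qpoch _ _ _; set x := 'X^a; set y := 'X^b; ring.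
apply: dvdp_add; first by rewrite qpochS mulrAC dvdp_mul.
by apply: dvdp_mulr; rewrite (qpochS _ _ b) mulrA dvdp_mul.
Qed.

Lemma one_subXn_neq0 i : (0 < i)%N -> 1 - 'X^i != 0 :> {poly rat}.
Proof.
by move=> i0; rewrite -oppr_eq0 opprB -size_poly_eq0 -polyC1 size_XnsubC.
Qed.

Lemma qpochXX_neq0 k : qpoch 'X 'X k != 0 :> {poly rat}.
Proof.
elim: k => [|k IH]; first by rewrite qpoch0 oner_eq0.
by rewrite qpochS mulf_neq0 // -exprS one_subXn_neq0.
Qed.

Lemma qintM m : (1 - 'X) * qint m = 1 - 'X^m.
Proof. exact: geomM. Qed.

Lemma one_subX_neq0 : 1 - 'X != 0 :> {poly rat}.
Proof. exact: (@one_subXn_neq0 1). Qed.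

Lemma dvdp_qint m u : qint m %| qint (u * m).
Proof.
rewrite -(dvdp_mul2l _ _ one_subX_neq0) !qintM mulnC exprM.
by rewrite -[1 - 'X^m ^+ u]geomM dvdp_mulIl.
Qed.

(** A relation u m = v n + 1 gives [u m] - X [v n] = 1, which is a Bezout
relation because [m] divides [u m] and [n] divides [v n]. *)
Lemma coprimep_qint m n : (0 < m)%N -> coprime m n -> coprimep (qint m) (qint n).
Proof.
move=> m0 /eqP cmn; have [u v uv _] := egcdnP n m0.
apply/Bezout_eq1_coprimepP.
have [/= a Ha] := dvdpP _ _ (dvdp_qint m u).
have [/= b Hb] := dvdpP _ _ (dvdp_qint n v).
exists (a, - 'X * b) => /=; rewrite -mulrA -Ha -Hb uv cmn addn1.
rewrite /qint big_nat_recl // expr0 mulNr mulr_sumr.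
by under eq_bigr do rewrite exprS; rewrite addrK.
Qed.

(** [n] divides 1 - X^(i n) and, n being odd, 1 + X^i divides 1 + X^(i n);
these two multiples add up to 2. *)
Lemma coprimep_qint_1addXn n i : odd n -> coprimep (qint n) (1 + 'X^i).
Proof.
move=> n_odd.
apply: (@coprimep_dvdl _ (1 + 'X^(i * n))).
  have := subrXX ('X^i : {poly rat}) (-1) n.
  rewrite -signr_odd n_odd expr1 !opprK -exprM addrC [X in X * _]addrC => ->.
  exact: dvdp_mulIl.
apply: (coprimep_dvdr (dvdp_qint n i)).
apply/Bezout_eq1_coprimepP; exists ((2^-1)%:P * (1 - 'X), (2^-1)%:P) => /=.
rewrite -mulrA qintM -mulrDr addrACA addNr addr0 -polyC1 -polyCD -polyCM.
by [].
Qed.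

Lemma qpoch_parity (R : comPzRingType) (x : R) k :
  qpoch x (x ^+ 2) k * qpoch (x ^+ 2) (x ^+ 2) k = qpoch x x (2 * k).
Proof.
elim: k => [|k IH]; first by rewrite !qpoch0 mulr1.
rewrite mulnS !qpochS -IH -!exprM !exprS; ring.
Qed.

Lemma qpoch_sqr (R : comPzRingType) (x : R) k :
  qpoch x x k * qpoch (- x) x k = qpoch (x ^+ 2) (x ^+ 2) k.
Proof.
elim: k => [|k IH]; first by rewrite !qpoch0 mulr1.
rewrite !qpochS -IH -exprM mulnC exprM; ring.
Qed.

(** Here g is the central q-binomial coefficient of 2M over M. With
P = (-X; X)_M the closed form of the sum reads g^2 ([2M] + [2M+1]) / P^4, and
P is coprime to [n]. *)
Lemma sum_eq0_mod n M (g : {poly rat}) :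
    odd n -> qpoch 'X 'X (2 * M) = g * qpoch 'X 'X M ^+ 2 -> qint n %| g ->
  ratfun_eq0_mod
    (\sum_(0 <= k < M.+1)
        qpoch q^-1 (q ^+ 2) k ^+ 2 / qpoch (q ^+ 2) (q ^+ 2) k ^+ 2
        * q ^+ (2 * k))
    (qint n ^+ 2).
Proof.
move=> n_odd gE /dvdpP [w wE].
pose P : {poly rat} := qpoch (- 'X) 'X M.
have cop : coprimep (qint n) P.
  rewrite /P; elim: M {P gE} => [|M IH]; first by rewrite qpoch0 coprimep1.
  by rewrite qpochS coprimepMr IH mulNr opprK -exprS coprimep_qint_1addXn.
have A0 := qpochXX_neq0 M.
have E0 : qpoch ('X ^+ 2) ('X ^+ 2) M != 0 :> {poly rat}.
  elim: M {gE P cop A0} => [|M IH]; first by rewrite qpoch0 oner_eq0.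
  by rewrite qpochS mulf_neq0 // -exprS -exprM one_subXn_neq0.
have P0 : P != 0 by apply: contraNneq E0; rewrite -qpoch_sqr -/P => ->; rewrite mulr0.
exists (w ^+ 2 * (qint (2 * M) + qint (2 * M).+1)), (P ^+ 4).
split; first exact: expf_neq0.
  by rewrite coprimep_expl // coprimep_expr.
have OE : qpoch 'X ('X ^+ 2) M * P = g * qpoch 'X 'X M.
  apply: (mulfI A0); rewrite mulrCA qpoch_sqr qpoch_parity gE; ring.
rewrite sum_qpoch_ratio.
- have fq m : \sum_(0 <= i < m) q ^+ i = tofrac (qint m).
    by rewrite /qint rmorph_sum; apply: eq_bigr => i _; rewrite rmorphXn.
  rewrite !fq -!rmorphXn -!rmorph_qpoch -!rmorphD -!rmorphXn /=.
  have t0 (p : {poly rat}) : p != 0 -> tofrac p != 0 by rewrite tofrac_eq0.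
  apply/eqP; rewrite mulrAC eqr_div ?t0 ?expf_neq0 // -!rmorphM.
  apply/eqP; congr (tofrac _).
  rewrite -qpoch_sqr -/P.
  transitivity ((qpoch 'X ('X^2) M * P) ^+ 2 * P ^+ 2 *
    (qint (2 * M) + qint (2 * M).+1)); first by ring.
  rewrite OE wE; ring.
- by rewrite tofrac_eq0 polyX_eq0.
- move=> i i0; rewrite -rmorphXn -tofrac1 -subr_eq0 -rmorphB tofrac_eq0.
  by rewrite -oppr_eq0 opprB one_subXn_neq0.
Qed.

(** Comparing g with the neighbouring coefficient h of 2n-2 over n gives
g [n-1] = h [n], and [n-1] is coprime to [n]. *)
Lemma qint_dvd_central n (g : {poly rat}) :
  (0 < n)%N -> qpoch 'X 'X (2 * n.-1) = g * qpoch 'X 'X n.-1 ^+ 2 -> qint n %| g.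
Proof.
case: n => [|[|m]] //= _ gE.
  by rewrite /qint big_nat1 expr0 dvd1p.
have /dvdpP [h hE] := qpochDdvd m.+2 m.
rewrite -(@Gauss_dvdpl _ _ (qint m.+1)); last first.
  by rewrite coprimep_qint // coprimeSn.
apply/dvdpP; exists h.
apply: (mulfI one_subX_neq0); rewrite mulrCA [RHS]mulrCA !qintM.
have A0 := qpochXX_neq0 m; have A1 := qpochXX_neq0 m.+1.
apply: (mulIf A1); apply: (mulIf A0).
transitivity (qpoch 'X 'X (2 * m.+1) : {poly rat}).
  by rewrite gE !(qpochS _ _ m) exprS; ring.
rewrite (_ : (2 * m.+1 = m.+2 + m)%N); last by lia.
by rewrite hE (qpochS _ _ m.+1) -exprS; ring.
Qed.

(** With h the coefficient of 2M-2 over M, g [M] [M-1] = h [2M] [2M-1], and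
2M - 1 is coprime to both M and M - 1. *)
Lemma qint_dvd_central_pred M (g : {poly rat}) :
    (1 < M)%N -> qpoch 'X 'X (2 * M) = g * qpoch 'X 'X M ^+ 2 ->
  qint (2 * M).-1 %| g.
Proof.
case: M => [|[|m]] // _ gE.
have -> : ((2 * m.+2).-1 = (2 * m).+3)%N by lia.
have /dvdpP [h hE] := qpochDdvd m.+2 m.
rewrite -(@Gauss_dvdpl _ _ (qint m.+2 * qint m.+1)); last first.
  have e2 : (2 * m).+3 = (m.+2 + m.+1)%N by lia.
  rewrite coprimepMr; apply/andP; split; apply: coprimep_qint => //.
    by rewrite e2 coprime_sym /coprime gcdnDl; exact: coprimeSn.
  by rewrite e2 coprime_sym /coprime gcdnDr; exact: coprimenS.
apply/dvdpP; exists (h * qint (2 * m).+4).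
have D2 : (1 - 'X) ^+ 2 != 0 :> {poly rat} by rewrite expf_neq0 ?one_subX_neq0.
apply: (mulIf D2).
transitivity (g * ((1 - 'X) * qint m.+2) * ((1 - 'X) * qint m.+1)); first by ring.
transitivity (h * ((1 - 'X) * qint (2 * m).+4) * ((1 - 'X) * qint (2 * m).+3));
  last by ring.
rewrite !qintM.
have A0 := qpochXX_neq0 m; have A1 := qpochXX_neq0 m.+2.
apply: (mulIf A1); apply: (mulIf A0).
transitivity (qpoch 'X 'X (2 * m.+2) : {poly rat}).
  by rewrite gE !(qpochS _ _ m.+1) !(qpochS _ _ m) -!exprS; ring.
have -> : (2 * m.+2 = (2 * m).+4)%N by lia.
rewrite (qpochS _ _ (2 * m).+3) (qpochS _ _ (2 * m).+2) -!exprS.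
have -> : ((2 * m).+2 = m.+2 + m)%N by lia.
by rewrite hE; ring.
Qed.

Theorem theorem3 (n : nat) (n_gt1 : (1 < n)%N) (n_odd : odd n) :
  ratfun_eq0_mod
    (\sum_(0 <= k < n)
        qpoch q^-1 (q ^+ 2) k ^+ 2 / qpoch (q ^+ 2) (q ^+ 2) k ^+ 2
        * q ^+ (2 * k))
    (qint n ^+ 2)
  /\
  ratfun_eq0_mod
    (\sum_(0 <= k < (n.+1 %/ 2).+1)
        qpoch q^-1 (q ^+ 2) k ^+ 2 / qpoch (q ^+ 2) (q ^+ 2) k ^+ 2
        * q ^+ (2 * k))
    (qint n ^+ 2).
Proof.
split.
- case: n n_gt1 n_odd => [//|m] _ n_odd.
  have /dvdpP [g gE] := qpochDdvd m m.
  rewrite addnn -mul2n -expr2 in gE.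
  by apply: (sum_eq0_mod n_odd gE); exact: (@qint_dvd_central m.+1).
- set M := (n.+1 %/ 2)%N.
  have nE : n = (2 * M).-1 by lia.
  have /dvdpP [g gE] := qpochDdvd M M.
  rewrite addnn -mul2n -expr2 in gE.
  apply: (sum_eq0_mod n_odd gE); rewrite nE.
  by apply: qint_dvd_central_pred gE; lia.
Qed.
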